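(* Let $M$ be the inverse monoid defined by a finite presentation $\mathcal{P}=\mathrm{Inv}\langle A\mid R\rangle$ with $A=\{a_1,\ldots,a_m\}$, and let $i\in\{1,\ldots,m\}$. Assume that $M$ has finite $\mathcal{R}$-classes. If for every idempotent $e\in E(M_i)$ the set of preimages $\{g\in M:\epsilon_i^{\mathcal{P}}(g)=e\}$ has a minimum idempotent (i.e. among the idempotents in this set there is a minimum one for the natural partial order of $M$), then $M_i$ also has finite $\mathcal{R}$-classes.
   Context: For a set $B$ put $\widetilde{B}=B\cup B^{-1}$, with $B^{-1}$ a set of formal inverses, and extend $^{-1}$ to an involution of the free monoid $\widetilde{B}^*$ by $1^{-1}=1$, $(uv)^{-1}=v^{-1}u^{-1}$. Let $\rho_B$ be the congruence on $\widetilde{B}^*$ generated by all pairs $(ww^{-1}w,w)$ and $(uu^{-1}vv^{-1},vv^{-1}uu^{-1})$ with $u,v,w\in\widetilde{B}^*$. The inverse monoid defined by $\mathrm{Inv}\langle B\mid S\rangle$, $S\subseteq\widetilde{B}^*\times\widetilde{B}^*$, is $\widetilde{B}^*/(\rho_B\cup S)^\sharp$, where $^\sharp$ denotes the generated congruence. Let $A_i=A\setminus\{a_i\}$ and let $\theta_i:\widetilde{A}^*\to\widetilde{A_i}^*$ be the homomorphism deleting the letters $a_i,a_i^{-1}$ and fixing the others. Put $R\overline{\theta}_i=\{(u\theta_i,v\theta_i)\mid (u,v)\in R\}$ and $M_i=\widetilde{A_i}^*/(\rho_{A_i}\cup R\overline{\theta}_i)^\sharp$. The map $\epsilon_i^{\mathcal{P}}:M\to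 M_i$ sending the class of $w\in\widetilde{A}^*$ to the class of $w\theta_i$ is a well-defined surjective homomorphism. In an inverse monoid $N$, $E(N)$ is the set of idempotents; the natural partial order is $u\le v$ iff $u=ev$ for some $e\in E(N)$; and $u\,\mathcal{R}\,v$ iff $uu^{-1}=vv^{-1}$. ''Finite $\mathcal{R}$-classes'' means every $\mathcal{R}$-class is finite. *)

(* Defs.v *)
From HB Require Import structures.
From mathcomp Require Import all_boot.
From mathcomp Require Import boolp classical_sets functions cardinality.

Set Implicit Arguments.
Unset Strict Implicit.
Unset Printing Implicit Defensive.

Import Algebra.

Local Open Scope classical_set_scope.
Local Open Scope quotient_scope.
Local Open Scope group_scope.

(* Together with the axioms of *-monoids, these two identities say that x^-1  *)
(* is the unique inverse of x, i.e. they define the inverse monoids.          *)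
HB.mixin Record StarMonoid_isInverseMonoid N of StarMonoid N := {
  mulgV_regular : forall x : N, x * x^-1 * x = x;
  idem_mulgVC : forall x y : N,
    x * x^-1 * (y * y^-1) = y * y^-1 * (x * x^-1)
}.

#[short(type="inverseMonoidType")]
HB.structure Definition InverseMonoid :=
  {N of StarMonoid_isInverseMonoid N & StarMonoid N}.

Section InverseMonoidTheory.
Variable N : inverseMonoidType.

Definition idempotents : set N := [set e | e * e = e].

Definition nat_le (u v : N) : Prop := exists2 e, idempotents e & u = e * v.

Definition greenR (u v : N) : Prop := u * u^-1 = v * v^-1.

Definition minimum_idempotent (X : set N) (f : N) : Prop :=
  [/\ X f, idempotents f &
      forall g, X g -> idempotents g -> nat_le f g].

End InverseMonoidTheory.

Definition finite_greenR_classes (N : inverseMonoidType) : Prop :=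
  forall u : N, finite_set [set v | greenR u v].

(* The free monoid on B and its formal inverses: the letter (b, false) stands *)
(* for b and (b, true) for b^-1.                                              *)
Definition word (B : Type) : Type := seq (B * bool).

Definition winv (B : Type) (w : word B) : word B :=
  rev [seq (x.1, ~~ x.2) | x <- w].

Inductive cong (B : Type) (S : set (word B * word B)) :
    word B -> word B -> Prop :=
  | cong_gen u v : S (u, v) -> cong S u v
  | cong_refl u : cong S u u
  | cong_sym u v : cong S u v -> cong S v u
  | cong_trans v u w : cong S u v -> cong S v w -> cong S u w
  | cong_cat u u' v v' :
      cong S u u' -> cong S v v' -> cong S (u ++ v) (u' ++ v').

Definition rho_gens (B : Type) : set (word B * word B) :=
  [set p | (exists w, p = (w ++ winv w ++ w, w)) \/
           (exists u v, p = (u ++ winv u ++ v ++ winv v,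
                             v ++ winv v ++ u ++ winv u))].

Definition rho (B : Type) : set (word B * word B) :=
  [set p | cong (@rho_gens B) p.1 p.2].

Definition pres_cong (B : Type) (S : set (word B * word B)) :
    word B -> word B -> Prop :=
  cong (@rho B `|` S).

Section Presentation.
Variables (B : choiceType) (S : set (word B * word B)).
Implicit Types u v w : word B.

Lemma winvK : involutive (@winv B).
Proof.
by move=> w; rewrite /winv map_rev revK -map_comp map_id_in // => -[b s] _ /=;
   rewrite negbK.
Qed.

Lemma winv_cat u v : winv (u ++ v) = winv v ++ winv u.
Proof. by rewrite /winv map_cat rev_cat. Qed.

Lemma pres_cong_wVw w : pres_cong S (w ++ winv w ++ w) w.
Proof. by apply: cong_gen; left; apply: cong_gen; left; exists w. Qed.

Lemma pres_cong_wVC u v :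
  pres_cong S (u ++ winv u ++ v ++ winv v) (v ++ winv v ++ u ++ winv u).
Proof. by apply: cong_gen; left; apply: cong_gen; right; exists u, v. Qed.

Lemma pres_cong_catl u v w : pres_cong S v w -> pres_cong S (u ++ v) (u ++ w).
Proof. by move=> vw; apply: cong_cat => //; exact: cong_refl. Qed.

Lemma pres_cong_catr u v w : pres_cong S v w -> pres_cong S (v ++ u) (w ++ u).
Proof. by move=> vw; apply: cong_cat => //; exact: cong_refl. Qed.

Definition pres_rel : rel (word B) := fun u v => `[< pres_cong S u v >].

Lemma pres_rel_refl : reflexive pres_rel.
Proof. by move=> u; apply/asboolP; exact: cong_refl. Qed.

Lemma pres_rel_sym : symmetric pres_rel.
Proof. by move=> u v; apply/asboolP/asboolP; exact: cong_sym. Qed.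

Lemma pres_rel_trans : transitive pres_rel.
Proof.
by move=> v u w /asboolP uv /asboolP vw; apply/asboolP; exact: cong_trans vw.
Qed.

Canonical pres_equiv := EquivRel pres_rel
  pres_rel_refl pres_rel_sym pres_rel_trans.

Definition inv_pres : Type := {eq_quot pres_equiv}.
HB.instance Definition _ := Choice.on inv_pres.

Definition wclass (w : word B) : inv_pres := \pi_{eq_quot pres_equiv} w.
Definition wrep (x : inv_pres) : word B := repr (x : {eq_quot pres_equiv}).

Lemma wrepK : cancel wrep wclass.
Proof. by move=> x; rewrite /wclass /wrep reprK. Qed.

Lemma wclassP u v : wclass u = wclass v <-> pres_cong S u v.
Proof.
split; first by move/eqmodP/asboolP.
by move=> uv; apply/eqmodP/asboolP.
Qed.

Definition ip_mul (x y : inv_pres) : inv_pres := wclass (wrep x ++ wrep y).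
Definition ip_one : inv_pres := wclass [::].
Definition ip_inv (x : inv_pres) : inv_pres := wclass (winv (wrep x)).

Lemma wrep_wclass w : pres_cong S (wrep (wclass w)) w.
Proof. by apply/wclassP; rewrite wrepK. Qed.

Lemma wclass_cat u v : wclass (u ++ v) = ip_mul (wclass u) (wclass v).
Proof.
by apply/esym/wclassP; apply: cong_cat; exact: wrep_wclass.
Qed.

Let wclass_ind (P : inv_pres -> Prop) :
  (forall w, P (wclass w)) -> forall x, P x.
Proof. by move=> Pc x; rewrite -(wrepK x). Qed.

Lemma ip_mulA : associative ip_mul.
Proof.
elim/wclass_ind=> u; elim/wclass_ind=> v; elim/wclass_ind=> w.
by rewrite -!wclass_cat catA.
Qed.

Lemma ip_mul1 : left_id ip_one ip_mul.
Proof. by elim/wclass_ind=> u; rewrite -wclass_cat. Qed.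

Let wVw w :
  ip_mul (wclass w) (ip_mul (wclass (winv w)) (wclass w)) = wclass w.
Proof. by rewrite -!wclass_cat; apply/wclassP; exact: pres_cong_wVw. Qed.

Let wVC u v :
  ip_mul (wclass u) (ip_mul (wclass (winv u))
    (ip_mul (wclass v) (wclass (winv v)))) =
  ip_mul (wclass v) (ip_mul (wclass (winv v))
    (ip_mul (wclass u) (wclass (winv u)))).
Proof. by rewrite -!wclass_cat; apply/wclassP; exact: pres_cong_wVC. Qed.

(* S need not be closed under inversion: this is uniqueness of inverses. *)
Lemma pres_cong_winv u v : pres_cong S u v -> pres_cong S (winv u) (winv v).
Proof.
move=> /wclassP uv; apply/wclassP.
have := wVw u; have := wVw v; have := wVw (winv u); have := wVw (winv v).
have := wVC u v; have := wVC (winv u) (winv v).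
rewrite !winvK -uv.
move: (wclass u) (wclass (winv u)) (wclass (winv v)) => x p q.
move=> C2 C1 qxq pxp xqx xpx.
have -> : p = ip_mul p (ip_mul x q).
  rewrite -{1}pxp -{1}xqx -!ip_mulA -C1 !ip_mulA.
  by rewrite -(ip_mulA p x p) pxp.
rewrite -{1}xqx !ip_mulA -(ip_mulA _ q x) -(ip_mulA p) C2.
by rewrite -!ip_mulA (ip_mulA x p) (ip_mulA (ip_mul x p))
  -(ip_mulA x p x) xpx.
Qed.

Lemma wclass_winv u : wclass (winv u) = ip_inv (wclass u).
Proof. by apply/esym/wclassP/pres_cong_winv/wrep_wclass. Qed.

Lemma ip_invK : involutive ip_inv.
Proof. by elim/wclass_ind=> u; rewrite -!wclass_winv winvK. Qed.

Lemma ip_invM : {morph ip_inv : x y / ip_mul x y >-> ip_mul y x}.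
Proof.
elim/wclass_ind=> u; elim/wclass_ind=> v.
by rewrite -wclass_cat -!wclass_winv winv_cat wclass_cat.
Qed.

HB.instance Definition _ :=
  isStarMonoid.Build inv_pres
    ip_mulA ip_mul1 ip_invK ip_invM.

Lemma ip_regular (x : inv_pres) : x * x^-1 * x = x.
Proof.
elim/wclass_ind: x => u.
rewrite -[_ * _]/(ip_mul (ip_mul _ (ip_inv _)) _) -wclass_winv.
by rewrite -ip_mulA wVw.
Qed.

Lemma ip_idem_mulgVC (x y : inv_pres) :
  x * x^-1 * (y * y^-1) = y * y^-1 * (x * x^-1).
Proof.
elim/wclass_ind: x => u; elim/wclass_ind: y => v.
have E z t : z * z^-1 * (t * t^-1) =
    ip_mul (ip_mul z (ip_inv z)) (ip_mul t (ip_inv t)) by [].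
by rewrite !E -!wclass_winv -!ip_mulA wVC.
Qed.

HB.instance Definition _ :=
  StarMonoid_isInverseMonoid.Build inv_pres ip_regular ip_idem_mulgVC.

End Presentation.

Section Deletion.
Variables (A : choiceType) (a : A).

Definition alphabet_minus : Type := {b : A | b != a}.
HB.instance Definition _ := Choice.on alphabet_minus.

Definition theta (w : word A) : word alphabet_minus :=
  pmap (fun x => omap (fun b : alphabet_minus => (b, x.2)) (insub x.1)) w.

Variable R : set (word A * word A).

Definition theta_rels : set (word alphabet_minus * word alphabet_minus) :=
  [set (theta p.1, theta p.2) | p in R].

Definition epsilon (x : inv_pres R) : inv_pres theta_rels :=
  wclass theta_rels (theta (wrep x)).

Lemma theta_cat u v : theta (u ++ v) = theta u ++ theta v.
Proof. exact: pmap_cat. Qed.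

Lemma theta_winv w : theta (winv w) = winv (theta w).
Proof.
elim: w => // -[b s] w IH.
rewrite -cat1s winv_cat !theta_cat winv_cat IH; congr (_ ++ _).
by rewrite /theta /winv /=; case: insubP.
Qed.

Lemma theta_rho p : rho p -> rho (theta p.1, theta p.2).
Proof.
rewrite /rho /=; elim=> {p} [u v|u|u v _|v u w _ + _|u u' v v' _ + _].
- case=> [[w [-> ->]]|[w [z [-> ->]]]]; apply: cong_gen; [left|right].
    by exists (theta w); rewrite !theta_cat theta_winv.
  by exists (theta w), (theta z); rewrite !theta_cat !theta_winv.
- exact: cong_refl.
- exact: cong_sym.
- exact: cong_trans.
- by rewrite !theta_cat; exact: cong_cat.
Qed.

Lemma theta_pres_cong u v :
  pres_cong R u v -> pres_cong theta_rels (theta u) (theta v).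
Proof.
elim=> {u v} [u v|u|u v _|v u w _ + _|u u' v v' _ + _].
- case=> [/theta_rho ?|Ruv]; apply: cong_gen; first by left.
  by right; exists (u, v).
- exact: cong_refl.
- exact: cong_sym.
- exact: cong_trans.
- by rewrite !theta_cat; exact: cong_cat.
Qed.

Lemma epsilon_wclass w : epsilon (wclass R w) = wclass theta_rels (theta w).
Proof. by apply/wclassP/theta_pres_cong/wrep_wclass. Qed.

Lemma epsilonM : {morph epsilon : x y / x * y}.
Proof.
move=> x y; rewrite -(wrepK x) -(wrepK y).
rewrite -[_ * _ in LHS]wclass_cat !epsilon_wclass.
by rewrite theta_cat wclass_cat.
Qed.

Lemma epsilon1 : epsilon 1 = 1.
Proof. exact: epsilon_wclass. Qed.

HB.instance Definition _ :=
  isUMagmaMorphism.Build (inv_pres R) (inv_pres theta_rels) epsilon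
    (epsilon1, epsilonM).

Lemma epsilon_surj (y : inv_pres theta_rels) : exists x, epsilon x = y.
Proof.
exists (wclass R [seq (val p.1, p.2) | p <- wrep y]).
rewrite epsilon_wclass -[RHS]wrepK; congr wclass.
by elim: (wrep y) => //= -[b s] w IH; rewrite /theta /= valK /= -/(theta _) IH.
Qed.

End Deletion.

Arguments theta {A} a w.
Arguments theta_rels {A} a R _.
Arguments epsilon {A} a {R} x.

(* Main.v *)
(* If f is the minimum idempotent above e = u u^-1, then the R-class of f     *)
(* maps onto the R-class of u: for v in the latter and g a preimage of v, the *)
(* element f g also lies above v, and the idempotent (f g)(f g)^-1 <= f lies  *)
(* above e, so it equals f by minimality.                                     *)

Require Import Defs.
From mathcomp Require Import all_boot.
From mathcomp Require Import boolp classical_sets functions cardinality.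

Local Open Scope classical_set_scope.

Import Algebra.

Lemma idempotent_mulgV (N : inverseMonoidType) (x : N) :
  idempotents (x * x^-1)%g.
Proof. by rewrite /idempotents /= mulgA mulgV_regular. Qed.

(** Holds because deleting letters commutes with formal inversion; it serves to place [h] below in
    the fibre of [u * u^-1]. *)
Lemma epsilonV (A : choiceType) (a : A) (R : set (word A * word A))
    (x : inv_pres R) :
  (epsilon a x^-1 = (epsilon a x)^-1)%g.
Proof.
rewrite -(wrepK x) -[(_^-1)%g in LHS]wclass_winv !epsilon_wclass theta_winv.
exact: wclass_winv.
Qed.

Theorem proposition4p16 (m : nat) (R : set (word 'I_m * word 'I_m)) (i : 'I_m) :
  finite_set R ->
  finite_greenR_classes (inv_pres R) ->
  (forall e : inv_pres (theta_rels i R), idempotents e ->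
     exists f : inv_pres R,
       minimum_idempotent [set g | epsilon i g = e] f) ->
  finite_greenR_classes (inv_pres (theta_rels i R)).
Proof.
move=> _ finM minM u.
have [f [/= ef ff fmin]] := minM _ (idempotent_mulgV _ u).
apply: sub_finite_set (finite_image (epsilon i) (finM f)) => v /= uv.
have [g gv] := epsilon_surj v.
(* The image of [f] is [u * u^-1 = v * v^-1], a left identity for [v]. *)
have efg : epsilon i (f * g)%g = v.
  by rewrite epsilonM ef gv uv mulgV_regular.
exists (f * g)%g => //.
set h := (f * g * (f * g)^-1)%g.
have hh : (h * h = h)%g := idempotent_mulgV _ (f * g)%g.
have eh : epsilon i h = (u * u^-1)%g by rewrite epsilonM epsilonV efg uv.
have [k _ fkh] := fmin h eh hh.
(* Antisymmetry: minimality gives [f * h = f], while [f * h = h] because [h] begins with the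
   idempotent [f]. *)
have fh : f = h.
  have fhf : (f * h = f)%g by rewrite {1}fkh -mulgA hh -fkh.
  by rewrite -fhf /h !mulgA ff.
(* [h] is its own inverse, so [f * f^-1 = h * h = h]. *)
by rewrite /greenR -/h {1 2}fh /h [((_ * _^-1)^-1)%g]invgM invgK.
Qed.
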